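(* Let $1\le d\le k-1$ and $m=k-d-1$. Then $$\mathfrak M_{[2k,2d]}(x)=\frac1x-\frac{\bigl(1-x^2(R_m(x^2)-R_d(x^2))\bigr)\bigl(1-x^2(R_d(x^2)+R_m(x^2))-x(1-x^2R_d(x^2)R_m(x^2))\bigr)}{x+x^3\bigl(1+x^2R_d^2(x^2)\bigr)\bigl(1-2R_m(x^2)+x^2R_m^2(x^2)\bigr)}.$$
   Context: $\mathfrak S_n$ is the set of permutations of $\{1,\dots,n\}$ (for $n=0$, the empty permutation, which is even). A permutation avoids a pattern $\tau$ of length $\ell$ if none of its length-$\ell$ subsequences is order-isomorphic to $\tau$. For $1\le d\le k$, $[k,d]$ denotes the pattern $(d+1)(d+2)\ldots k\,1\,2\ldots d\in\mathfrak S_k$. $\mathfrak M_\tau(x)=\mathfrak E_\tau(x)-\mathfrak O_\tau(x)$, where $\mathfrak E_\tau(x)$ (resp. $\mathfrak O_\tau(x)$) is the ordinary generating function in $n$ for the number of even (resp. odd) permutations in $\mathfrak S_n$, $n\ge0$, avoiding both $132$ and $\tau$. $U_r$ is the Chebyshev polynomial of the second kind: $U_0(t)=1$, $U_1(t)=2t$, $U_r(t)=2tU_{r-1}(t)-U_{r-2}(t)$. For $k\ge1$, $R_k(x)=\dfrac{U_{k-1}\left(\frac1{2\sqrt x}\right)}{\sqrt x\,U_k\left(\frac1{2\sqrt x}\right)}$, a rational function of $x$, and $R_0(x)=0$; equivalently $R_k(x)=1/(1-xR_{k-1}(x))$ for $k\ge1$. $R_k^2(x^2)$ means $(R_k(x^2))^2$.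 *)

(* Defs.v *)
From HB Require Import structures.
From mathcomp Require Import all_boot all_order all_fingroup all_algebra.
From mathcomp Require Import fraction boolp.

Set Implicit Arguments.
Unset Strict Implicit.
Unset Printing Implicit Defensive.

Import GRing.Theory.
Local Open Scope ring_scope.

(* [fps F] is F[[x]], an integral domain, so [{fraction (fps F)}] is the field
   F((x)) of formal Laurent series, in which 1/x and quotients make sense. *)

Record fps (F : fieldType) := Fps { fcoef : nat -> F }.

Section FpsRing.
Variable F : fieldType.
Implicit Types f g h : fps F.

HB.instance Definition _ := gen_eqMixin (fps F).
HB.instance Definition _ := gen_choiceMixin (fps F).

Lemma fpsP f g : fcoef f =1 fcoef g <-> f = g.
Proof.
split=> [|-> //]; case: f g => [f] [g] /= fg.
by congr Fps; apply/funext.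
Qed.

Definition fps0 : fps F := Fps (fun=> 0).
Definition fps1 : fps F := Fps (fun n => (n == 0)%:R).
Definition fpsX : fps F := Fps (fun n => (n == 1)%:R).
Definition fps_opp f := Fps (fun n => - fcoef f n).
Definition fps_add f g := Fps (fun n => fcoef f n + fcoef g n).
Definition fps_mul f g :=
  Fps (fun n => \sum_(i < n.+1) fcoef f i * fcoef g (n - i)).

Fact fps_addA : associative fps_add.
Proof. by move=> f g h; apply/fpsP => n /=; rewrite addrA. Qed.
Fact fps_addC : commutative fps_add.
Proof. by move=> f g; apply/fpsP => n /=; rewrite addrC. Qed.
Fact fps_add0 : left_id fps0 fps_add.
Proof. by move=> f; apply/fpsP => n /=; rewrite add0r. Qed.
Fact fps_addN : left_inverse fps0 fps_opp fps_add.
Proof. by move=> f; apply/fpsP => n /=; rewrite addNr. Qed.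

HB.instance Definition _ :=
  GRing.isZmodule.Build (fps F) fps_addA fps_addC fps_add0 fps_addN.

Definition fps_trunc N f : {poly F} := \poly_(i < N) fcoef f i.

Fact coef_fps_trunc N f n :
  (n < N)%N -> (fps_trunc N f)`_n = fcoef f n.
Proof. by move=> ltnN; rewrite coef_poly ltnN. Qed.

Fact fps_mul_trunc N f g n : (n < N)%N ->
  fcoef (fps_mul f g) n = (fps_trunc N f * fps_trunc N g)`_n.
Proof.
move=> ltnN; rewrite coefM; apply: eq_bigr => i _.
rewrite !coef_fps_trunc //; first exact: leq_ltn_trans (leq_subr _ _) ltnN.
by apply: leq_ltn_trans ltnN; rewrite -ltnS.
Qed.

Fact coefM_eq (p p' q q' : {poly F}) n :
    (forall i, (i <= n)%N -> p`_i = p'`_i) ->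
    (forall i, (i <= n)%N -> q`_i = q'`_i) ->
  (p * q)`_n = (p' * q')`_n.
Proof.
move=> pp' qq'; rewrite !coefM; apply: eq_bigr => i _.
by rewrite pp' ?qq' ?leq_subr // -ltnS.
Qed.

Fact fps_mulC : commutative fps_mul.
Proof.
move=> f g; apply/fpsP => n.
by rewrite !(@fps_mul_trunc n.+1) // mulrC.
Qed.

Fact fps_mulA : associative fps_mul.
Proof.
move=> f g h; apply/fpsP => n.
have tM a b i : (i <= n)%N ->
    (fps_trunc n.+1 (fps_mul a b))`_i
      = (fps_trunc n.+1 a * fps_trunc n.+1 b)`_i.
  by move=> lein; rewrite coef_fps_trunc // (@fps_mul_trunc n.+1).
rewrite !(@fps_mul_trunc n.+1) //.
rewrite (coefM_eq (fun _ _ => erefl) (tM g h)).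
by rewrite (coefM_eq (tM f g) (fun _ _ => erefl)) mulrA.
Qed.

Fact fps_mul1 : left_id fps1 fps_mul.
Proof.
move=> f; apply/fpsP => n /=.
rewrite big_ord_recl /= mul1r subn0 big1 ?addr0 // => i _.
by rewrite mul0r.
Qed.

Fact fps_mulDl : left_distributive fps_mul fps_add.
Proof.
move=> f g h; apply/fpsP => n /=.
by rewrite -big_split; apply: eq_bigr => i _; rewrite mulrDl.
Qed.

Fact fps_oner_neq0 : fps1 != fps0.
Proof.
by apply/eqP => /fpsP /(_ 0); apply/eqP; rewrite oner_eq0.
Qed.

HB.instance Definition _ := GRing.Zmodule_isComNzRing.Build (fps F)
  fps_mulA fps_mulC fps_mul1 fps_mulDl fps_oner_neq0.

Definition fps_unit : pred (fps F) := fun f => `[< exists g, g * f = 1 >].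
Definition fps_inv f : fps F :=
  if pselect (exists g, g * f = 1) is left ex then projT1 (cid ex) else f.

Fact fps_mulVf : {in fps_unit, left_inverse 1 fps_inv *%R}.
Proof.
move=> f /asboolP ex; rewrite /fps_inv; case: pselect => // ex'.
by case: cid.
Qed.
Fact fps_unitPl f g : g * f = 1 -> fps_unit f.
Proof. by move=> gf1; apply/asboolP; exists g. Qed.
Fact fps_inv_out : {in [predC fps_unit], fps_inv =1 id}.
Proof.
move=> f /negP fNunit; rewrite /fps_inv; case: pselect => // ex.
by case: fNunit; apply/asboolP.
Qed.

HB.instance Definition _ := GRing.ComNzRing_hasMulInverse.Build (fps F)
  fps_mulVf fps_unitPl fps_inv_out.

Fact fps_order f : f != 0 ->
  exists2 n, fcoef f n != 0 & forall i, (i < n)%N -> fcoef f i = 0.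
Proof.
move=> f_neq0; have ex : exists n, fcoef f n != 0.
  apply: contrapT => nex; case/eqP: f_neq0; apply/fpsP => n.
  by apply/eqP; apply: contrapT => /negP fn; case: nex; exists n.
case: (ex_minnP ex) => n fn minn; exists n => // i ltin.
by apply/eqP; apply: contraTT ltin => /minn; rewrite -leqNgt.
Qed.

Fact fps_integral : GRing.integral_domain_axiom (fps F).
Proof.
move=> f g fg0; apply/norP => -[].
move=> /fps_order [a fa mina] /fps_order [b gb minb].
move/fpsP/(_ (a + b)%N): fg0 => /=; apply/eqP.
have lta : (a < (a + b).+1)%N by rewrite ltnS leq_addr.
rewrite (bigD1 (Ordinal lta)) //= addKn big1 ?addr0 ?mulf_neq0 //.
move=> i; rewrite -val_eqE /= neq_ltn => /orP[/mina-> | ltai].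
  by rewrite mul0r.
rewrite [X in _ * X]minb ?mulr0 // ltn_subLR ?ltn_add2r //.
by rewrite -ltnS.
Qed.

HB.instance Definition _ :=
  GRing.ComUnitRing_isIntegral.Build (fps F) fps_integral.

End FpsRing.

Arguments fpsX {F}.

(* A permutation of {1,...,n} is an element of ['S_n], with indices and values
   both shifted down by one; the pattern [tau] is a word over the positive
   integers, in one-line notation. *)

Definition contains n (tau : seq nat) (s : 'S_n) : bool :=
  [exists f : {ffun 'I_(size tau) -> 'I_n},
    [forall i : 'I_(size tau), forall j : 'I_(size tau),
       (i < j)%N ==> (f i < f j)%N] &&
    [forall i : 'I_(size tau), forall j : 'I_(size tau),
       (s (f i) < s (f j))%N == (nth 0%N tau i < nth 0%N tau j)%N]].

Definition avoids n (tau : seq nat) (s : 'S_n) : bool := ~~ contains tau s.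

Definition pat132 : seq nat := [:: 1; 3; 2]%N.

(* [k,d] = (d+1) (d+2) ... k 1 2 ... d *)
Definition pat (k d : nat) : seq nat := iota d.+1 (k - d) ++ iota 1 d.

Definition even_avoiders (tau : seq nat) (n : nat) : {set 'S_n} :=
  [set s : 'S_n | [&& ~~ odd_perm s, avoids pat132 s & avoids tau s]].

Definition odd_avoiders (tau : seq nat) (n : nat) : {set 'S_n} :=
  [set s : 'S_n | [&& odd_perm s, avoids pat132 s & avoids tau s]].

Definition gfE (tau : seq nat) : fps rat :=
  Fps (fun n => #|even_avoiders tau n|%:R).

Definition gfO (tau : seq nat) : fps rat :=
  Fps (fun n => #|odd_avoiders tau n|%:R).

Definition gfM (tau : seq nat) : fps rat := gfE tau - gfO tau.

(* U_r evaluated at an element of a ring. *)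
Fixpoint chebU (A : comNzRingType) (r : nat) (t : A) : A :=
  match r with
  | 0 => 1
  | r1.+1 => match r1 with
             | 0 => 2 * t
             | r2.+1 => 2 * t * chebU r1 t - chebU r2 t
             end
  end.

(* R_k involves the square root of its argument, so it is parametrized here by
   that root: [chebR k s] is R_k(s^2).  By [chebRN] the choice of the root
   is irrelevant. *)
Definition chebR (K : fieldType) (k : nat) (s : K) : K :=
  if k is j.+1 then chebU j (1 / (2 * s)) / (s * chebU j.+1 (1 / (2 * s)))
  else 0.

Fact chebUN (A : comNzRingType) r (t : A) :
  chebU r (- t) = (-1) ^+ r * chebU r t.
Proof.
suff: chebU r (- t) = (-1) ^+ r * chebU r t /\
      chebU r.+1 (- t) = (-1) ^+ r.+1 * chebU r.+1 t by case.
elim: r => [|r [IH0 IH1]]; first by rewrite /= !mul1r mulrN mulN1r.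
split=> //; rewrite [LHS]/= -/(chebU r.+1 (- t)) IH0 IH1.
rewrite [chebU r.+2 t]/= -/(chebU r.+1 t) !exprS !mulN1r opprK.
by rewrite mulrBr mulrN !mulNr mulrN opprK mulrCA.
Qed.

Fact chebRN (K : fieldType) k (s : K) : chebR k (- s) = chebR k s.
Proof.
case: k => [//|j]; rewrite /chebR mulrN invrN mulrN.
rewrite !chebUN exprS mulN1r !mulNr mulrN opprK [in LHS]mulrCA.
by rewrite -mulf_div divff ?mul1r // signr_eq0.
Qed.

(* Main.v *)
Require Import Defs.
From mathcomp Require Import all_boot all_order all_fingroup all_algebra.
From mathcomp Require Import fraction boolp ring zify.

(** Cut a 132-avoiding permutation at its largest entry: it reads L' n R, and
    avoiding 132 forces every entry of L' above every entry of R.  It is thus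
    [glue L R] for two arbitrary shorter 132-avoiders, of lengths l and r with
    l + r + 1 = n, and its inversion number is inv L + inv R + r (l + 1)
    ([inversions_glue]).  Signed generating functions of 132-avoiders therefore
    satisfy Catalan-like recursions for the product f * g twisted by the signs
    (-1)^(r (l + 1)), which is [fps_twist].

    The pattern of the theorem consists of an increasing run of length p + 1,
    p = 2m + 1, followed by an increasing run of length q = 2d made of smaller
    values.  The only way to cut it into a left part above a right part is
    between the runs.  Hence [glue L R] contains it iff L does, or R does, or
    else L contains 12...p (which n extends to p + 1 letters) and R contains
    12...q ([has_two_runs_glue]).  Containing the pattern implies containing
    12...p and 12...q, so with T, A, B the signed series of the avoiders of the
    pattern, of 12...p and of 12...q, inclusion-exclusion gives
        T = 1 + x (A * T + T * B - A * B)        ([signed_gf_two_runsS]),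
    and likewise I_(j+1) = 1 + x I_j * I_(j+1) for the signed series I_j of the
    avoiders of 12...j ([signed_gf_incrS]).

    The twisting sign depends only on the parities of l and r, so these are
    bilinear equations between even and odd parts.  Encoding a series by
    F = F_even + i F_odd turns x f * g into i x conj(F) G, whence
    I_(j+1) = 1 / (1 - i x conj(I_j)).  Two steps of this continued fraction
    amount to one step R -> 1 / (1 - x^2 R) of the recursion of R_j(x^2):
        I_(2j) = R_j / (1 - i x R_j)   and   I_(2j+1) = 1 + i x R_j
    ([incr_parity_parts], stated with real and imaginary parts).  The parts of
    A = I_(2m+1) and B = I_(2d) being known, those of T solve a linear system
    of two equations; its determinant times 1 + x^2 R_d^2 is the denominator
    of the theorem divided by x ([two_runs_system_solution]).  The
    quantities divided by, apart from x, are quotients of power series with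
    constant term 1, hence nonzero. *)

Set Implicit Arguments.
Unset Strict Implicit.
Unset Printing Implicit Defensive.

Import GRing.Theory.

(** * Permutations as words *)

Local Open Scope nat_scope.

Definition perm_word n (s : 'S_n) : seq nat := [seq val (s i) | i <- enum 'I_n].

(** Comparing strict inequalities only is enough for a pattern with distinct
    letters, and matches the way containment in a permutation is expressed. *)
Definition order_iso (u tau : seq nat) : Prop :=
  size u = size tau /\
  forall i j, (i < size tau) -> (j < size tau) ->
    (nth 0 u i < nth 0 u j) = (nth 0 tau i < nth 0 tau j).

Definition word_contains (tau w : seq nat) : Prop :=
  exists2 u, subseq u w & order_iso u tau.

Definition word_avoids (tau w : seq nat) : bool := ~~ `[< word_contains tau w >].

Fixpoint inversions (w : seq nat) : nat :=
  if w is a :: w1 then (count (fun b => b < a) w1 + inversions w1) else 0.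

Lemma sorted_enum_ord n : sorted (fun i j : 'I_n => (i < j)) (enum 'I_n).
Proof. by have := iota_ltn_sorted 0 n; rewrite -val_enum_ord sorted_map. Qed.

Lemma sorted_subseq_enum n (t : seq 'I_n) :
  sorted (fun i j : 'I_n => (i < j)) t -> subseq t (enum 'I_n).
Proof.
move=> t_sorted; have ltT : transitive (fun i j : 'I_n => (i < j)).
  by move=> j i l; apply: ltn_trans.
have -> : t = [seq i <- enum 'I_n | i \in t]; last exact: filter_subseq.
apply: (irr_sorted_eq ltT (fun i => ltnn i)) => //.
  by rewrite sorted_filter // sorted_enum_ord.
by move=> i; rewrite mem_filter mem_enum andbT.
Qed.

(** A choice of positions in increasing order is the same as a subsequence of
    the word: both are sublists of the enumeration of the positions. *)
Lemma contains_wordP n tau (s : 'S_n) :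
  contains tau s <-> word_contains tau (perm_word s).
Proof.
split=> [/existsP [f /andP [/forallP f_incr /forallP f_iso]]|].
  exists [seq val (s (f i)) | i <- enum 'I_(size tau)].
    rewrite /perm_word (map_comp (fun i => val (s i)) f).
    apply: map_subseq; apply: sorted_subseq_enum.
    apply: (homo_sorted (f := f)) (sorted_enum_ord _) => i j ij.
    by have /forallP /(_ j) /implyP /(_ ij) := f_incr i.
  split; first by rewrite size_map size_enum_ord.
  move=> i j ltin ltjn; pose i1 := Ordinal ltin; pose j1 := Ordinal ltjn.
  have nth_enum l (ltl : (l < size tau)) :
      nth 0 [seq val (s (f i)) | i <- enum 'I_(size tau)] l =
      val (s (f (Ordinal ltl))).
    rewrite (nth_map (Ordinal ltl) _ _ (s := enum 'I_(size tau))).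
      by congr (val (s (f _))); apply: (nth_ord_enum _ (Ordinal ltl)).
    by rewrite size_enum_ord.
  rewrite (nth_enum i ltin) (nth_enum j ltjn).
  by have /forallP /(_ j1) /eqP := f_iso i1.
case=> u /subseqP [m szm ->] [szu u_iso].
rewrite -map_mask in szu u_iso; set t := mask m (enum 'I_n) in szu u_iso.
have szt : size t = size tau by rewrite -szu size_map.
have t_sorted : sorted (fun i j : 'I_n => (i < j)) t.
  by apply: sorted_mask (sorted_enum_ord n) => j i l; apply: ltn_trans.
pose t' := Tuple (introT eqP szt).
apply/existsP; exists [ffun i => tnth t' i]; apply/andP; split.
  apply/forallP => i; apply/forallP => j; apply/implyP => ij; rewrite !ffunE.
  have x0 := tnth t' i; rewrite !(tnth_nth x0).
  by apply: (sorted_ltn_nth _ _ t_sorted);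
    rewrite ?inE ?szt // => b a c; apply: ltn_trans.
apply/forallP => i; apply/forallP => j; rewrite !ffunE -u_iso //.
have x0 := tnth t' i; rewrite !(tnth_nth x0).
by rewrite !(nth_map x0 _ _ (s := t)) ?szt.
Qed.

Lemma avoids_wordE n tau (s : 'S_n) :
  avoids tau s = word_avoids tau (perm_word s).
Proof.
by congr (~~ _); apply/idP/asboolP; rewrite contains_wordP.
Qed.

Lemma inversions_map f w : {in w &, {mono f : a b / (a < b)}} ->
  inversions (map f w) = inversions w.
Proof.
elim: w => //= a w IH mf; rewrite IH => [|b c bw cw]; last first.
  by apply: mf; rewrite inE ?bw ?cw orbT.
congr (_ + _); rewrite count_map; apply: eq_in_count => b bw /=.
by apply: mf; rewrite inE ?bw ?eqxx ?orbT.
Qed.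

Lemma perm_word_inj n : injective (@perm_word n).
Proof.
move=> s t /eq_in_map st; apply/permP => i; apply: val_inj.
by apply: st; rewrite mem_enum.
Qed.

Lemma perm_word_iota n (s : 'S_n) : perm_eq (perm_word s) (iota 0 n).
Proof.
rewrite /perm_word -val_enum_ord (map_comp val s); apply: perm_map.
apply: uniq_perm; rewrite ?(map_inj_uniq perm_inj) ?enum_uniq // => i.
rewrite mem_enum; apply/mapP; exists (s^-1 i)%g; rewrite ?mem_enum //.
by rewrite permKV.
Qed.

(** The map from permutations to words is injective, and both sides have n!
    elements. *)
Lemma perm_words n :
  perm_eq [seq perm_word s | s : 'S_n] (permutations (iota 0 n)).
Proof.
have uniq_words : uniq [seq perm_word s | s : 'S_n].
  by rewrite (map_inj_uniq (@perm_word_inj n)) enum_uniq.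
apply: uniq_perm; rewrite ?permutations_uniq //.
have [||_ eq_words] := uniq_min_size uniq_words (s2 := permutations (iota 0 n)).
  by move=> w /mapP [s _ ->]; rewrite mem_permutations perm_word_iota.
  rewrite size_map -cardE card_Sn size_permutations ?iota_uniq //.
  by rewrite size_iota.
exact: eq_words.
Qed.

(** Induction on n by deleting the first letter: [odd_lift_perm] says that this
    changes the sign by the parity of the deleted value, which is also the
    number of inversions that the first letter takes part in. *)
Lemma odd_perm_word n (s : 'S_n) : odd_perm s = odd (inversions (perm_word s)).
Proof.
elim: n s => [|n IH] s.
  by rewrite /perm_word (size0nil (size_enum_ord 0)) (_ : s = 1%g) ?odd_perm1 //;
    apply/permP => -[].
have lift_neq i : s (lift ord0 i) != s ord0.
  by rewrite (inj_eq perm_inj) eq_sym neq_lift.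
(* The permutation s without its first letter; the default is never reached. *)
pose f i := odflt i (unlift (s ord0) (s (lift ord0 i))).
have fE i : lift (s ord0) (f i) = s (lift ord0 i).
  rewrite /f; have := lift_neq i; case: unliftP => [j -> //|->].
  by rewrite eqxx.
have f_inj : injective f.
  move=> i j fij; apply: (@lift_inj _ ord0); apply: (@perm_inj _ s).
  by rewrite -!fE fij.
have -> : s = lift_perm ord0 (s ord0) (perm f_inj).
  apply/permP => i; case: (unliftP ord0 i) => [j ->|->].
    by rewrite lift_perm_lift permE fE.
  by rewrite lift_perm_id.
rewrite odd_lift_perm /= IH; set t := perm f_inj.
have -> : perm_word (lift_perm ord0 (s ord0) t) =
    val (s ord0) :: map (bump (s ord0)) (perm_word t).
  rewrite /perm_word enum_ordSl /= lift_perm_id -!map_comp; congr (_ :: _).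
  by apply: eq_map => i /=; rewrite lift_perm_lift.
rewrite /= oddD inversions_map; last first.
  by move=> a b _ _; rewrite /bump; lia.
congr (_ (+) _); congr odd; rewrite count_map.
rewrite (seq.permP (perm_word_iota t)).
set k := val (s ord0); have lekn : (k <= n) := leq_ord (s ord0).
rewrite -[in RHS](subnKC lekn) iotaD count_cat add0n.
rewrite (@eq_in_count _ _ predT) ?count_predT ?size_iota => [|b]; last first.
  by rewrite mem_iota /= /bump; lia.
rewrite (@eq_in_count _ _ pred0) ?count_pred0 ?addn0 // => b.
by rewrite mem_iota /= /bump; lia.
Qed.

(** * Occurrences of the patterns in words *)

Lemma subseq_catP (T : eqType) (u a b : seq T) : subseq u (a ++ b) ->
  exists u1 u2, [/\ u = u1 ++ u2, subseq u1 a & subseq u2 b].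
Proof.
case/subseqP => m szm ->.
exists (mask (take (size a) m) a), (mask (drop (size a) m) b).
rewrite -mask_cat ?mask_subseq ?cat_take_drop //.
by rewrite size_take_min szm size_cat; lia.
Qed.

Lemma subseq_mapP (T1 T2 : eqType) (f : T1 -> T2) u w : subseq u (map f w) ->
  exists2 v, u = map f v & subseq v w.
Proof.
by case/subseqP => m _ ->; exists (mask m w); rewrite ?map_mask ?mask_subseq.
Qed.

Lemma subseq_rconsP (T : eqType) (u w : seq T) c : subseq u (rcons w c) ->
  subseq u w \/ exists2 v, u = rcons v c & subseq v w.
Proof.
rewrite -cats1 => /subseq_catP [u1 [u2 [-> su1]]].
case: u2 => [|b [|b' u2]]; first by rewrite cats0; left.
  by rewrite sub1seq inE => /eqP ->; right; exists u1; rewrite ?cats1.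
by move/size_subseq.
Qed.

Definition has_incr (j : nat) (w : seq nat) : Prop :=
  exists u, [/\ subseq u w, size u = j & sorted ltn u].

(** The shape of an occurrence of (q+1) ... (q+p) 1 2 ... q. *)
Definition has_two_runs (p q : nat) (w : seq nat) : Prop :=
  exists u v, [/\ subseq (u ++ v) w, size u = p /\ size v = q,
    sorted ltn u, sorted ltn v & {in u & v, forall a b, b < a}].

Definition has_132 (w : seq nat) : Prop :=
  exists a b c, [/\ subseq [:: a; c; b] w, a < b & b < c].

Lemma nth_ltn_sorted u i j : sorted ltn u -> i < size u -> j < size u ->
  (nth 0 u i < nth 0 u j) = (i < j).
Proof.
move=> su ui uj; have lt i' j' := sorted_ltn_nth ltn_trans 0 su i' j'.
case: (ltngtP i j) => ij; first exact: lt.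
  by apply/negbTE; rewrite -leqNgt ltnW // lt.
by rewrite ij ltnn.
Qed.

Lemma contains_132_has_132 w : word_contains pat132 w <-> has_132 w.
Proof.
split=> [[u uw [szu iso]]|[a [b [c [uw ab bc]]]]].
  case: u => [|a [|c [|b [|]]]]// in uw szu iso *.
  have := iso 0 2 isT isT; have := iso 2 1 isT isT => /= bc ab.
  by exists a, b, c; rewrite ab bc.
exists [:: a; c; b] => //; split=> // -[|[|[|i]]] // [|[|[|j]]] //= _ _; lia.
Qed.

(** Position by position comparison: two letters of the pattern in the same run
    are ordered as their positions, and the first run is above the second. *)
Lemma contains_pat_has_two_runs p q w :
  word_contains (pat (p + q) q) w <-> has_two_runs p q w.
Proof.
have nth_pat i : i < p + q -> nth 0 (pat (p + q) q) i =
    if i < p then q.+1 + i else (i - p).+1.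
  move=> ipq; rewrite nth_cat size_iota addnK.
  by case: ltnP => ip; rewrite nth_iota //; lia.
have nth_patl i : i < p -> nth 0 (pat (p + q) q) i = q.+1 + i.
  by move=> ip; rewrite nth_pat ?ip; lia.
have nth_patr i : i < q -> nth 0 (pat (p + q) q) (p + i) = i.+1.
  by move=> iq; rewrite nth_pat ?ltn_add2l // ltnNge leq_addr addKn.
have size_pat : size (pat (p + q) q) = p + q.
  by rewrite size_cat !size_iota addnK.
split=> [[u uw []]|].
  rewrite size_pat => szu iso; exists (take p u), (drop p u).
  have szt : size (take p u) = p by rewrite size_takel // szu leq_addr.
  have szd : size (drop p u) = q by rewrite size_drop szu addKn.
  rewrite cat_take_drop; split=> //.
  - apply/(sortedP 0) => i; rewrite szt => ip; have ip' := ltnW ip.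
    by rewrite /= !nth_take // iso ?nth_patl //; lia.
  - apply/(sortedP 0) => i; rewrite szd => iq; have iq' := ltnW iq.
    by rewrite /= !nth_drop iso ?nth_patr //; lia.
  - move=> a b /(nthP 0) [i + <-] /(nthP 0) [j + <-]; rewrite szt szd => ip jq.
    by rewrite nth_take // nth_drop iso ?nth_patr ?nth_patl //; lia.
case=> u [v [uvw [szu szv] su sv vu]]; exists (u ++ v) => //; split.
  by rewrite size_pat size_cat szu szv.
rewrite size_pat => i j ipq jpq; rewrite !(nth_cat 0 u v) !nth_pat // szu.
have vu' k l : k < p -> l < q -> nth 0 v l < nth 0 u k.
  by move=> kp lq; apply: vu; rewrite mem_nth ?szu ?szv.
case: (ltnP i p) => ip; case: (ltnP j p) => jp.
- by rewrite nth_ltn_sorted ?szu // ltn_add2l.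
- by have := vu' i (j - p) ip; lia.
- by have := vu' j (i - p) jp; lia.
- by rewrite nth_ltn_sorted ?szv; lia.
Qed.

(** * Words split at their largest letter *)

(** The letters of R are kept, those of L are raised above them, and the new
    largest letter sits in between. *)
Definition glue (L R : seq nat) : seq nat :=
  map (addn (size R)) L ++ (size L + size R) :: R.

Definition bounded (w : seq nat) : bool := all (fun a => a < size w) w.

Lemma ltn_addn_map r (L : seq nat) : {in L &, {mono addn r : a b / a < b}}.
Proof. by move=> a b _ _; rewrite ltn_add2l. Qed.

Lemma sorted_map_addn r u : sorted ltn (map (addn r) u) = sorted ltn u.
Proof. by apply: mono_sorted => a b; rewrite /= ltn_add2l. Qed.

(** The subwords of the part of [glue L R] up to its largest letter, according
    to whether that letter, which is then the last one, is used. *)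
Definition left_subword (L R u : seq nat) : Prop :=
  (exists2 v, subseq v L & u = map (addn (size R)) v) \/
  (exists2 v, subseq v L & u = rcons (map (addn (size R)) v) (size L + size R)
                           /\ {in v, forall a, a < size L}).

(** Of an increasing subword, dropping the last letter removes the largest
    letter of [glue L R] if it was used at all. *)
Lemma left_subword_incr j L R u :
  left_subword L R u -> size u = j.+1 -> sorted ltn u -> has_incr j L.
Proof.
case=> [[v sv ->]|[v sv [-> _]]].
  rewrite size_map sorted_map_addn => szv su.
  exists (take j v); rewrite size_takel ?szv // take_sorted //; split=> //.
  exact: subseq_trans (take_subseq _ _) sv.
rewrite size_rcons size_map => -[szv] su; exists v; split=> //.
rewrite -(sorted_map_addn (size R)).
by apply: subseq_sorted su; [apply: ltn_trans|rewrite -cats1 prefix_subseq].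
Qed.

(** An occurrence in [glue L R] is cut into a left part and a right part that
    lies below it; the analysis of each pattern is about which cuts of it put
    all of the left letters above all of the right ones. *)
Lemma subseq_glueP L R u : bounded L -> bounded R -> subseq u (glue L R) ->
  exists v1 v2, [/\ u = v1 ++ v2, subseq v2 R,
    {in v1 & v2, forall a b, b < a} & left_subword L R v1].
Proof.
move=> /allP bL /allP bR; rewrite /glue -cat_rcons.
case/subseq_catP => v1 [v2 [-> s1 s2]].
exists v1, v2; split=> //.
  move=> a b av1 /(mem_subseq s2) /bR bltR.
  have := mem_subseq s1 av1; rewrite mem_rcons inE => /predU1P [->|].
    by apply: leq_trans bltR _; rewrite leq_addl.
  by case/mapP => a' _ ->; apply: leq_trans bltR _; rewrite leq_addr.
case: (subseq_rconsP s1) => [|[v ->]] /subseq_mapP [v' -> sv']; [left|right].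
  by exists v'.
by exists v' => //; split=> // a /(mem_subseq sv') /bL.
Qed.

Lemma subseq_glue_left L R v : subseq v L ->
  subseq (rcons (map (addn (size R)) v) (size L + size R)) (glue L R).
Proof.
move=> sv; rewrite /glue -cat_rcons; apply: subseq_trans (prefix_subseq _ _).
by rewrite -!cats1 cat_subseq // map_subseq.
Qed.

Lemma subseq_glue_mapl L R v : subseq v L ->
  subseq (map (addn (size R)) v) (glue L R).
Proof.
move=> sv; apply: subseq_trans (subseq_glue_left R sv); rewrite -cats1.
exact: prefix_subseq.
Qed.

Lemma subseq_glue_right L R v : subseq v R -> subseq v (glue L R).
Proof.
move=> sv; rewrite /glue -cat_rcons; apply: subseq_trans sv (suffix_subseq _ _).
Qed.

(** An increasing word cannot be cut with its left part above its right part,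
    so an occurrence lies on one side; on the left, the largest letter
    contributes one letter to the longest increasing subwords. *)
Lemma has_incr_glue j L R : bounded L -> bounded R ->
  has_incr j.+1 (glue L R) <-> has_incr j L \/ has_incr j.+1 R.
Proof.
move=> bL bR; split=> [[u [uw szu su]]|[[u [uw szu su]]|[u [uw szu su]]]].
- have [v1 [v2 [eu sv2 lt12 cases]]] := subseq_glueP bL bR uw; subst u.
  case: v2 => [|b v2] in sv2 lt12 szu su uw *; last first.
    case: v1 => [|a v1] in cases lt12 szu su uw *.
      by right; exists (b :: v2).
    have := subseq_sorted ltn_trans (_ : subseq [:: a; b] _) su.
    rewrite (@cat_subseq _ [:: a] [:: b]) ?sub1seq ?mem_head // => /(_ isT).
    by rewrite /= andbT ltnNge ltnW // lt12 ?mem_head.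
  by rewrite cats0 in szu su; left; apply: left_subword_incr cases szu su.
- exists (rcons (map (addn (size R)) u) (size L + size R)).
  rewrite subseq_glue_left // size_rcons size_map szu; split=> //.
  rewrite sorted_pairwise ?pairwise_rcons; last exact: ltn_trans.
  rewrite -sorted_pairwise ?sorted_map_addn ?su ?andbT; last exact: ltn_trans.
  apply/allP => _ /mapP [a au ->].
  by rewrite /= addnC ltn_add2r; have /allP := bL; apply; apply: mem_subseq au.
by exists u; rewrite subseq_glue_right.
Qed.

(** No proper cut of 132 has its left part above its right part, and the
    largest letter of [glue L R] comes last on its side, where it cannot play
    the 3. *)
Lemma has_132_glue L R : bounded L -> bounded R ->
  has_132 (glue L R) <-> has_132 L \/ has_132 R.
Proof.
move=> bL bR; split=> [[a [b [c [uw ab bc]]]]|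
  [[a [b [c [uw ab bc]]]]|[a [b [c [uw ab bc]]]]]].
- have [v1 [v2 [eu sv2 lt12 cases]]] := subseq_glueP bL bR uw.
  case: v2 => [|b' v2] in sv2 lt12 eu *; last first.
    case: v1 => [|a' v1] in cases lt12 eu *.
      by right; exists a, b, c; rewrite eu.
    have ba : b < a; last by move: ba ab; lia.
    case: eu => -> eu; apply: lt12; rewrite ?mem_head //.
    have := congr1 (last b) eu; rewrite last_cat /= => ->.
    exact: mem_last.
  rewrite cats0 in eu; left; subst v1.
  case: cases => [[v sv]|[v sv []]].
    case: v sv => [|a' [|c' [|b' []]]] // sv [ea ec eb].
    by exists a', b', c'; split=> //; lia.
  rewrite -[[:: a; c; b]]/(rcons [:: a; c] b) => /rcons_inj [].
  case: v sv => [|a' [|c' []]] // sv [ea ec] eb lv.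
  by have := lv c'; rewrite !inE eqxx orbT => /(_ isT); lia.
- exists (size R + a), (size R + b), (size R + c).
  by rewrite (subseq_glue_mapl R uw) !ltn_add2l.
by exists a, b, c; rewrite subseq_glue_right.
Qed.

Lemma eq_cat_split (T : Type) (a b c d : seq T) : a ++ b = c ++ d ->
  size c <= size a -> exists2 t, a = c ++ t & d = t ++ b.
Proof.
move=> e le_ca; exists (drop (size c) a).
  by rewrite -{1}(take_size_cat d (erefl (size c))) -e takel_cat // cat_take_drop.
rewrite -[LHS](drop_size_cat d (erefl (size c))) -e drop_cat.
by case: ltngtP le_ca => // ->; rewrite subnn drop0 drop_size.
Qed.

Lemma sorted_cat_lt a b u v : sorted ltn (a :: u ++ b :: v) -> a < b.
Proof.
rewrite /= (path_sortedE ltn_trans) => /andP [/allP lt_a _].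
by apply: lt_a; rewrite mem_cat mem_head orbT.
Qed.

(** The pattern can be cut with its left part above its right part only between
    its two runs.  An occurrence on the left side avoids the largest letter,
    which is last there, because the last letter of the pattern is not its
    largest: this is where [0 < q] is used. *)
Lemma has_two_runs_glue p q L R : 0 < q -> bounded L -> bounded R ->
  has_two_runs p.+1 q (glue L R) <->
  has_two_runs p.+1 q L \/ has_two_runs p.+1 q R \/ has_incr p L /\ has_incr q R.
Proof.
move=> q0 bL bR; split.
- case=> u [v [uvw [szu szv] su sv vu]].
  have [v1 [v2 [e sv2 lt12 left1]]] := subseq_glueP bL bR uvw.
  case: (ltngtP (size v1) (size u)) => [lt1u|ltu1|eq1u].
  + have [t eu ev2] := eq_cat_split e (ltnW lt1u).
    case: v1 => [|a v1] in eu e lt12 left1 lt1u *.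
      by right; left; exists u, v; rewrite e.
    case: t => [|b t] in eu ev2.
      by rewrite eu cats0 ltnn in lt1u.
    rewrite eu in su; have := sorted_cat_lt su.
    by rewrite ltnNge ltnW // lt12 ?ev2 ?mem_head.
  + have [t ev1 ev] := eq_cat_split (esym e) (ltnW ltu1).
    case: t => [|b t] in ev1 ev; first by rewrite ev1 cats0 ltnn in ltu1.
    case: v2 => [|c v2] in ev lt12 e sv2; last first.
      rewrite ev in sv; have := sorted_cat_lt sv.
      by rewrite ltnNge ltnW // lt12 ?ev1 ?mem_cat ?mem_head ?orbT.
    rewrite cats0 in e; case: left1 => [[w sw ew]|[w sw [ew lew]]].
      set f := addn (size R) in ew.
      have eu : u = map f (take (size u) w).
        by rewrite map_take -ew -e take_size_cat.
      have ev' : v = map f (drop (size u) w).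
        by rewrite map_drop -ew -e drop_size_cat.
      left; exists (take (size u) w), (drop (size u) w); split.
      * by rewrite cat_take_drop.
      * by rewrite -(size_map f) -eu -(size_map f (drop _ _)) -ev'.
      * by rewrite -(sorted_map_addn (size R)) -eu.
      * by rewrite -(sorted_map_addn (size R)) -ev'.
      move=> a c aw cw; rewrite -(ltn_add2l (size R)).
      by apply: vu; rewrite 1?eu 1?ev' map_f.
    case: u => [|a u] // in szu uvw su vu e ltu1 ev1 *.
(* The largest letter would be the last of v, hence below the first of u. *)
    have lastv : last a v = size L + size R.
      have := congr1 (last a) e; rewrite ew last_rcons /= last_cat ev.
      by [].
    have /vu : last a v \in v by rewrite ev /= mem_last.
    move=> /(_ a (mem_head _ _)); rewrite lastv.
    have : a \in v1 by rewrite ev1 mem_head.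
    rewrite ew mem_rcons inE => /predU1P [->|/mapP [a' /lew]]; lia.
  + have [t eu ev2] := eq_cat_split e (eq_leq eq1u).
    case: t => [|b t] in eu ev2; last first.
      by move: eq1u; rewrite eu size_cat /=; lia.
    rewrite cats0 in eu; subst v1; right; right; split.
      exact: left_subword_incr left1 szu su.
    by exists v; split=> //; rewrite -[v]/([::] ++ v) -ev2.
case=> [[u [v [uvw [szu szv] su sv vu]]]|[[u [v [uvw szuv su sv vu]]]|]].
- exists (map (addn (size R)) u), (map (addn (size R)) v).
  rewrite -map_cat subseq_glue_mapl // !size_map !sorted_map_addn; split=> //.
  move=> _ _ /mapP [a au ->] /mapP [b bv ->]; rewrite ltn_add2l; exact: vu.
- by exists u, v; split=> //; apply: subseq_glue_right.
case=> [[u [uw szu su]] [v [vw szv sv]]].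
exists (rcons (map (addn (size R)) u) (size L + size R)), v.
have ltu a : a \in u -> a < size L.
  by move=> au; have /allP := bL; apply; apply: mem_subseq au.
split=> //.
- rewrite /glue -cat_rcons; apply: cat_subseq => //.
  by rewrite -!cats1 cat_subseq // map_subseq.
- by rewrite size_rcons size_map szu.
- rewrite sorted_pairwise ?pairwise_rcons; last exact: ltn_trans.
  rewrite -sorted_pairwise ?sorted_map_addn ?su ?andbT; last exact: ltn_trans.
  by apply/allP => _ /mapP [a au ->]; rewrite /= addnC ltn_add2r ltu.
move=> a b; rewrite mem_rcons inE => + /(mem_subseq vw) bR'.
have ltb : b < size R by have /allP := bR; apply.
by case/predU1P => [->|/mapP [a' _ ->]]; lia.
Qed.

Lemma perm_iota_size w n : perm_eq w (iota 0 n) -> size w = n.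
Proof. by move/perm_size; rewrite size_iota. Qed.

Lemma perm_iota_bounded w n : perm_eq w (iota 0 n) -> bounded w.
Proof.
move=> pw; apply/allP => a; rewrite (perm_iota_size pw) (perm_mem pw).
by rewrite mem_iota.
Qed.

Lemma perm_glue L R l r : perm_eq L (iota 0 l) -> perm_eq R (iota 0 r) ->
  perm_eq (glue L R) (iota 0 (l + r).+1).
Proof.
move=> pL pR; rewrite /glue (perm_iota_size pL) (perm_iota_size pR).
have -> : iota 0 (l + r).+1 =
    iota 0 r ++ rcons (map (addn r) (iota 0 l)) (l + r).
  by rewrite -iotaDl addn0 -cats1 catA -iotaD addnC -addn1 iotaD.
by rewrite -cat_rcons perm_catC perm_cat // -!cats1 perm_cat // perm_map.
Qed.

(** A letter left of the maximum and smaller than a letter right of it would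
    form a 132 with the maximum.  So all of the right side is below the left
    side, and sorting each side gives the two halves of an interval. *)
Lemma glue_decompose n w : perm_eq w (iota 0 n.+1) -> ~ has_132 w ->
  exists L R, [/\ w = glue L R, size L + size R = n,
    perm_eq L (iota 0 (size L)) & perm_eq R (iota 0 (size R))].
Proof.
move=> pw no132; have uw : uniq w by rewrite (perm_uniq pw) iota_uniq.
have nw : n \in w by rewrite (perm_mem pw) mem_iota ltnSn.
case/splitPr: nw pw no132 uw => p1 p2 pw no132.
rewrite cat_uniq /= negb_or => /and3P [_ /andP [np1 /hasPn p12] /andP [np2 _]].
have lt_n b : b \in p1 ++ n :: p2 -> b < n.+1.
  by rewrite (perm_mem pw) mem_iota.
have lt12 : {in p2 & p1, forall b a, b < a}.
  move=> b a bp2 ap1; case: (ltngtP b a) => // [ab|ba]; last first.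
    by have := p12 b bp2; rewrite ba ap1.
  case: no132; exists a, b, n; split=> //.
    by rewrite (@cat_subseq _ [:: a] [:: n; b]) ?sub1seq //= eqxx sub1seq.
  have := lt_n b; rewrite mem_cat inE bp2 !orbT => /(_ isT).
  rewrite ltnS leq_eqVlt => /predU1P [bn|//].
  by move: np2; rewrite -bn bp2.
have p21 : perm_eq (p2 ++ p1) (iota 0 n).
  rewrite perm_catC -(perm_cons n) (perm_trans _ (_ : perm_eq (iota 0 n.+1) _)) //.
    by rewrite (perm_trans _ pw) // -cat1s perm_catCA.
  by rewrite -addn1 iotaD add0n perm_catC.
have szn : size p2 + size p1 = n by rewrite -size_cat (perm_iota_size p21).
(* Both sides are sorted lists with the same letters. *)
have : sort leq p2 ++ sort leq p1 = iota 0 (size p2) ++ iota (size p2) (size p1).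
  rewrite -[X in iota X (size p1)](add0n (size p2)) -iotaD szn.
  apply: (sorted_eq leq_trans anti_leq); last 1 first.
  - by apply: perm_trans p21; apply: perm_cat; rewrite perm_sort.
  - rewrite (sorted_pairwise leq_trans) pairwise_cat.
    rewrite -!(sorted_pairwise leq_trans) !(sort_sorted leq_total) !andbT.
    apply/allrelP => b a; rewrite !mem_sort => bp2 ap1.
    exact: ltnW (lt12 _ _ bp2 ap1).
  exact: iota_sorted.
move/eqP; rewrite eqseq_cat ?size_sort ?size_iota // => /andP [/eqP s2 /eqP s1].
have pp2 : perm_eq p2 (iota 0 (size p2)) by rewrite -s2 perm_sym perm_sort.
have pp1 : perm_eq p1 (iota (size p2) (size p1)).
  by rewrite -s1 perm_sym perm_sort.
exists (map (subn^~ (size p2)) p1), p2; rewrite size_map; split=> //.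
- rewrite /glue size_map addnC szn -map_comp map_id_in // => a.
  by rewrite (perm_mem pp1) mem_iota /= => /andP [/subnKC].
- by rewrite addnC.
rewrite (perm_trans (perm_map _ pp1)) // -[X in iota X _](addn0 (size p2)).
rewrite iotaDl -map_comp map_id_in // => a _.
by rewrite /= addKn.
Qed.

(** The position of the largest letter gives back the size of L. *)
Lemma glue_inj L R L' R' : bounded L -> bounded L' ->
  size L + size R = size L' + size R' -> glue L R = glue L' R' ->
  L = L' /\ R = R'.
Proof.
move=> bL bL' esz e; have index_glue K Q : bounded K ->
    index (size K + size Q) (glue K Q) = size K.
  move=> /allP bK; rewrite index_cat size_map /= eqxx addn0.
  case: ifP => // /mapP [a /bK]; lia.
have szL : size L = size L'.
  by rewrite -(index_glue _ R bL) -(index_glue _ R' bL') e esz.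
have szR : size R = size R' by move: esz; rewrite szL => /addnI.
move/eqP: e; rewrite eqseq_cat ?size_map // szR => /andP [/eqP eL /eqP [_ ->]].
by split=> //; apply: inj_map eL => a b /addnI.
Qed.

Lemma inversions_cat u v :
  inversions (u ++ v) =
  inversions u + inversions v + \sum_(a <- u) count (fun b => b < a) v.
Proof.
elim: u => [|a u IH] /=; first by rewrite big_nil addn0.
by rewrite IH big_cons count_cat; lia.
Qed.

(** The letters of R are below the l letters of L and below the largest letter,
    hence the r (l + 1) inversions across the cut. *)
Lemma inversions_glue L R : bounded L -> bounded R ->
  inversions (glue L R) =
  inversions L + inversions R + size R * (size L).+1.
Proof.
move=> /allP bL /allP bR.
rewrite inversions_cat /= inversions_map; last exact: ltn_addn_map.
have -> : count (fun b => b < size L + size R) R = size R.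
  apply/eqP; rewrite -all_count; apply/allP => b /bR bltR.
  by rewrite (leq_trans bltR) ?leq_addl.
rewrite big_map (eq_big_seq (fun=> size R)) => [|a /bL altL /=]; last first.
  have -> : (size L + size R < size R + a) = false.
    by rewrite addnC ltn_add2l ltnNge ltnW.
  rewrite add0n.
  apply/eqP; rewrite -all_count; apply/allP => b /bR bltR.
  by rewrite (leq_trans bltR) ?leq_addr.
by rewrite big_const_seq count_predT iter_addn_0 mulnS (addnC (size R)) !addnA.
Qed.

(** * Signed generating functions *)

Local Open Scope ring_scope.

(** The Cauchy product carrying the sign of the r (l + 1) inversions between
    the two sides of [glue L R], with l = i and r = n - i. *)
Definition fps_twist (F : fieldType) (f g : fps F) : fps F :=
  Fps (fun n => \sum_(i < n.+1)
                 (-1) ^+ ((n - i) * i.+1) * (fcoef f i * fcoef g (n - i))).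

Definition words132 n : seq (seq nat) :=
  [seq w <- permutations (iota 0 n) | word_avoids pat132 w].

Lemma words132P n w :
  reflect (perm_eq w (iota 0 n) /\ ~ has_132 w) (w \in words132 n).
Proof.
rewrite mem_filter mem_permutations andbC; apply: (iffP andP) => -[pw av].
  by split=> // /contains_132_has_132 c; move: av; rewrite /word_avoids asboolT.
by split=> //; apply/asboolPn => /contains_132_has_132.
Qed.

Lemma perm_words132S n :
  perm_eq (words132 n.+1)
    [seq glue LR.1 LR.2 | l <- iota 0 n.+1,
                LR <- [seq (L, R) | L <- words132 l, R <- words132 (n - l)]].
Proof.
have uw k : uniq (words132 k) by rewrite filter_uniq ?permutations_uniq.
apply: uniq_perm => //.
  apply: allpairs_uniq_dep; first exact: iota_uniq.
    by move=> l _; apply: allpairs_uniq => // -[? ?] [? ?] _ _ [-> ->].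
  move=> _ _ /allpairsPdep [l [p [ln pl ->]]]
    /allpairsPdep [l' [p' [ln' pl' ->]]].
  case/allpairsP: pl => -[L R] [/= Lw Rw ->].
  case/allpairsP: pl' => -[L' R'] [/= Lw' Rw' ->].
  case/words132P: Lw => pL _; case/words132P: Lw' => pL' _.
  case/words132P: Rw => pR _; case/words132P: Rw' => pR' _.
  case/glue_inj.
  - exact: perm_iota_bounded pL.
  - exact: perm_iota_bounded pL'.
  - rewrite (perm_iota_size pL) (perm_iota_size pL').
    rewrite (perm_iota_size pR) (perm_iota_size pR').
    by rewrite !mem_iota in ln ln'; lia.
  move=> /= eL eR; subst L' R'.
  by have -> : l = l' by rewrite -(perm_iota_size pL) -(perm_iota_size pL').
move=> w; apply/words132P/allpairsPdep => [[pw nw]|].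
  have [L [R [ew szn pL pR]]] := glue_decompose pw nw; subst w.
  have [nL nR] : ~ has_132 L /\ ~ has_132 R.
    by split=> c; apply: nw; apply/has_132_glue;
      rewrite ?(perm_iota_bounded pL) ?(perm_iota_bounded pR) //; auto.
  exists (size L), (L, R); split=> //.
    by rewrite mem_iota; lia.
  apply/allpairsP; exists (L, R); split=> //; apply/words132P => //.
  by rewrite -szn addKn.
case=> l [_ [ln /allpairsP [[L R] [/= + + ->]] ->]].
move=> /words132P [pL nL] /words132P [pR nR].
split.
  by have := perm_glue pL pR; rewrite subnKC //; rewrite mem_iota in ln; lia.
by case/has_132_glue; rewrite ?(perm_iota_bounded pL) ?(perm_iota_bounded pR).
Qed.

Definition signed_gf (P : pred (seq nat)) : fps rat :=
  Fps (fun n => \sum_(w <- words132 n) (-1) ^+ inversions w * (P w)%:R).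

Lemma big_words132S n (F : seq nat -> rat) :
  \sum_(w <- words132 n.+1) F w =
  \sum_(l < n.+1) \sum_(L <- words132 l) \sum_(R <- words132 (n - l))
     F (glue L R).
Proof.
rewrite (perm_big _ (perm_words132S n)) big_allpairs_dep.
rewrite -[iota 0 n.+1]/(index_iota 0 n.+1) big_mkord; apply: eq_bigr => l _.
by rewrite big_allpairs.
Qed.

Lemma fps_twist_signed_gf (P Q : pred (seq nat)) n :
  fcoef (fps_twist (signed_gf P) (signed_gf Q)) n =
  \sum_(l < n.+1) \sum_(L <- words132 l) \sum_(R <- words132 (n - l))
     (-1) ^+ inversions (glue L R) * (P L && Q R)%:R.
Proof.
apply: eq_bigr => l _; rewrite /= big_distrlr /= mulr_sumr.
rewrite !big_seq; apply: eq_bigr => L /words132P [pL _].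
rewrite mulr_sumr !big_seq; apply: eq_bigr => R /words132P [pR _].
rewrite inversions_glue ?(perm_iota_bounded pL) ?(perm_iota_bounded pR) //.
rewrite (perm_iota_size pL) (perm_iota_size pR) !exprD -mulnb natrM.
ring.
Qed.

Lemma signed_gf_nil (P : pred (seq nat)) : fcoef (signed_gf P) 0 = (P [::])%:R.
Proof.
rewrite /= /words132 (_ : permutations _ = [:: [::]]) //=.
case: ifP => [_|/negP []]; first by rewrite big_seq1 mul1r.
by rewrite asboolF // => /contains_132_has_132 [a [b [c []]]].
Qed.

Lemma gfM_signed_gf tau : gfM tau = signed_gf (word_avoids tau).
Proof.
have card_sum n (A : {set 'S_n}) : #|A|%:R = \sum_s (s \in A)%:R :> rat.
  by rewrite -sum1_card natr_sum big_mkcond; apply: eq_bigr => s _; case: ifP.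
apply/fpsP => n.
rewrite -[LHS]/(#|even_avoiders tau n|%:R - #|odd_avoiders tau n|%:R).
rewrite /= big_filter -(perm_big _ (perm_words n)) big_map big_enum_cond /=.
rewrite !card_sum -sumrB [RHS]big_mkcond; apply: eq_bigr => s _.
rewrite !inE !avoids_wordE -signr_odd -odd_perm_word.
by case: odd_perm; case: word_avoids; case: word_avoids;
  rewrite ?mulr1 ?mulr0 ?subr0 ?sub0r.
Qed.

Definition signed_gf_incr j : fps rat :=
  signed_gf (fun w => ~~ `[< has_incr j w >]).

Definition signed_gf_two_runs p q : fps rat :=
  signed_gf (fun w => ~~ `[< has_two_runs p q w >]).

Lemma has_incr0 w : has_incr 0 w.
Proof. by exists [::]; rewrite sub0seq. Qed.

Lemma has_two_runs_incrl p q w : has_two_runs p.+1 q w -> has_incr p w.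
Proof.
case=> u [v [uvw [szu _] su _ _]]; exists (take p u).
rewrite size_takel ?szu // take_sorted //; split=> //.
apply: subseq_trans uvw; apply: subseq_trans (take_subseq _ _) _.
exact: prefix_subseq.
Qed.

Lemma has_two_runs_incrr p q w : has_two_runs p q w -> has_incr q w.
Proof.
case=> u [v [uvw [_ szv] _ sv _]]; exists v; split=> //.
exact: subseq_trans (suffix_subseq _ _) uvw.
Qed.

Lemma signed_gf_incr0 : signed_gf_incr 0 = 0.
Proof.
apply/fpsP => n /=; apply: big1_seq => w _.
by rewrite (asboolT (has_incr0 w)) mulr0.
Qed.

Lemma signed_gf_incrS_nil j : fcoef (signed_gf_incr j.+1) 0 = 1.
Proof.
rewrite signed_gf_nil asboolF // => -[u []]; rewrite subseq0 => /eqP -> //.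
Qed.

(** Here [glue L R] is avoiding exactly when both sides avoid their own pattern,
    so the coefficients split as products. *)
Lemma signed_gf_incrS j n :
  fcoef (signed_gf_incr j.+1) n.+1 =
  fcoef (fps_twist (signed_gf_incr j) (signed_gf_incr j.+1)) n.
Proof.
rewrite fps_twist_signed_gf [LHS]big_words132S; apply: eq_bigr => l _.
rewrite !big_seq; apply: eq_bigr => L /words132P [pL _].
rewrite !big_seq; apply: eq_bigr => R /words132P [pR _].
have := has_incr_glue j (perm_iota_bounded pL) (perm_iota_bounded pR).
by move/asbool_equiv_eq => ->; rewrite asbool_or negb_or.
Qed.

Lemma signed_gf_two_runs_nil p q : fcoef (signed_gf_two_runs p.+1 q) 0 = 1.
Proof.
rewrite signed_gf_nil asboolF // => -[[|a u] [v []]] //.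
by move=> _ [].
Qed.

(** Avoidance by [glue L R] means that both sides avoid the pattern and that L
    avoids 12...p or R avoids 12...q.  Since avoiding the shorter pattern implies
    avoiding the pattern itself, inclusion-exclusion leaves three products. *)
Lemma signed_gf_two_runsS p q n : (0 < q)%N ->
  fcoef (signed_gf_two_runs p.+1 q) n.+1 =
  fcoef (fps_twist (signed_gf_incr p) (signed_gf_two_runs p.+1 q)
         + fps_twist (signed_gf_two_runs p.+1 q) (signed_gf_incr q)
         - fps_twist (signed_gf_incr p) (signed_gf_incr q)) n.
Proof.
move=> q0; rewrite -[RHS]/(fcoef (fps_twist _ _) n + fcoef (fps_twist _ _) n
  - fcoef (fps_twist _ _) n).
rewrite !fps_twist_signed_gf [LHS]big_words132S -big_split -sumrB.
apply: eq_bigr => l _; rewrite /= -big_split -sumrB !big_seq.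
apply: eq_bigr => L /words132P [pL _]; rewrite /= -big_split -sumrB !big_seq.
apply: eq_bigr => R /words132P [pR _]; rewrite /= -mulrDr -mulrBr.
congr (_ * _).
have := has_two_runs_glue p q0 (perm_iota_bounded pL) (perm_iota_bounded pR).
move/asbool_equiv_eq => ->; rewrite !asbool_or asbool_and.
have incL : `[< has_two_runs p.+1 q L >] ==> `[< has_incr p L >].
  by apply/implyP => /asboolP /has_two_runs_incrl /asboolP.
have incR : `[< has_two_runs p.+1 q R >] ==> `[< has_incr q R >].
  by apply/implyP => /asboolP /has_two_runs_incrr /asboolP.
case: `[< has_two_runs p.+1 q L >] incL; case: `[< has_incr p L >] => //= _;
case: `[< has_two_runs p.+1 q R >] incR; case: `[< has_incr q R >] => //= _;
by rewrite ?(addr0, add0r, subr0, subrr, addrK).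
Qed.

(** * Parity parts of power series *)

Definition fps_even (F : fieldType) (f : fps F) : fps F :=
  Fps (fun n => if odd n then 0 else fcoef f n).

Definition fps_odd (F : fieldType) (f : fps F) : fps F :=
  Fps (fun n => if odd n then fcoef f n else 0).

Lemma fps_even_odd (F : fieldType) (f : fps F) : fps_even f + fps_odd f = f.
Proof. by apply/fpsP => n /=; case: odd; rewrite ?add0r ?addr0. Qed.

(** The sign (-1)^(r (l + 1)) is -1 exactly when l is even and r is odd. *)
Lemma fps_odd_twist (F : fieldType) (f g : fps F) :
  fps_odd (fps_twist f g) =
  fps_odd f * fps_even g - fps_even f * fps_odd g.
Proof.
apply/fpsP => n /=; rewrite -sumrB.
case: ifP => n_odd; [|apply/esym/big1 => i _]; last first.
  have := n_odd; rewrite -{1}(subnKC (leq_ord i)) oddD.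
  by case: (odd i); case: (odd (n - i)) => //= _; rewrite ?mulr0 ?mul0r subr0.
apply: eq_bigr => i _; rewrite -signr_odd oddM /=.
have := n_odd; rewrite -{1}(subnKC (leq_ord i)) oddD.
case: (odd i); case: (odd (n - i)) => //= _.
  by rewrite mul1r mul0r subr0.
by rewrite mulN1r mul0r sub0r.
Qed.

Lemma fps_even_twist (F : fieldType) (f g : fps F) :
  fps_even (fps_twist f g) =
  fps_even f * fps_even g + fps_odd f * fps_odd g.
Proof.
apply/fpsP => n /=; rewrite -big_split /=.
case: ifP => n_odd; [apply/esym/big1 => i _|].
  have := n_odd; rewrite -{1}(subnKC (leq_ord i)) oddD.
  by case: (odd i); case: (odd (n - i)) => //= _; rewrite ?mulr0 ?mul0r addr0.
apply: eq_bigr => i _; rewrite -signr_odd oddM /=.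
have := n_odd; rewrite -{1}(subnKC (leq_ord i)) oddD.
case: (odd i); case: (odd (n - i)) => //= _.
  by rewrite mul1r mul0r add0r.
by rewrite mul1r mul0r addr0.
Qed.

Lemma fcoef0D (F : fieldType) (f g : fps F) :
  fcoef (f + g) 0 = fcoef f 0 + fcoef g 0.
Proof. by []. Qed.

Lemma fcoef0M (F : fieldType) (f g : fps F) :
  fcoef (f * g) 0 = fcoef f 0 * fcoef g 0.
Proof. by rewrite /= big_ord1 subn0. Qed.

Lemma fcoefXM (F : fieldType) (f : fps F) n :
  fcoef (fpsX * f) n.+1 = fcoef f n.
Proof.
rewrite /= big_ord_recl mul0r add0r big_ord_recl /= mul1r subSS subn0.
by rewrite big1 ?addr0 // => i _; rewrite mul0r.
Qed.

(** All the recursions for signed series have the form f = 1 + x h, and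
    multiplication by x exchanges the parities. *)
Lemma fps_parity_shift (F : fieldType) (f h : fps F) :
  fcoef f 0 = 1 -> (forall n, fcoef f n.+1 = fcoef h n) ->
  fps_even f = 1 + fpsX * fps_odd h /\ fps_odd f = fpsX * fps_even h.
Proof.
move=> f0 fS; split; apply/fpsP => -[|n].
- by rewrite /= f0 big_ord1 mul0r addr0.
- rewrite -[RHS]/(0 + fcoef (fpsX * fps_odd h) n.+1) fcoefXM add0r /= fS.
  by case: odd.
- by rewrite /= big_ord1 mul0r.
- by rewrite fcoefXM /= fS; case: odd.
Qed.

(** * Chebyshev polynomials at 1/(2s) *)

(** [cheb_poly s (j + 1)] is s^j U_j(1/(2s)): clearing denominators makes sense
    of the Chebyshev recursion over power series, where every term from the
    index 1 on has constant term 1.  The value 0 at the index 0 makes R_j the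
    quotient of two consecutive terms for all j, including R_0 = 0. *)
Fixpoint cheb_poly (A : comNzRingType) (s : A) (j : nat) : A :=
  match j with
  | 0 => 0
  | j1.+1 => match j1 with
             | 0 => 1
             | j2.+1 => cheb_poly s j1 - s ^+ 2 * cheb_poly s j2
             end
  end.

Lemma cheb_polySS (A : comNzRingType) (s : A) j :
  cheb_poly s j.+2 = cheb_poly s j.+1 - s ^+ 2 * cheb_poly s j.
Proof. by []. Qed.

Lemma rmorph_cheb_poly (A B : comNzRingType) (f : {rmorphism A -> B}) (s : A) j :
  f (cheb_poly s j) = cheb_poly (f s) j.
Proof.
suff: f (cheb_poly s j) = cheb_poly (f s) j /\
      f (cheb_poly s j.+1) = cheb_poly (f s) j.+1 by case.
elim: j => [|j [IH0 IH1]]; first by rewrite /= rmorph0 rmorph1.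
by split=> //; rewrite !cheb_polySS rmorphB rmorphM rmorphXn IH0 IH1.
Qed.

Lemma chebUE (K : fieldType) (s : K) j : 2%:R != 0 :> K -> s != 0 ->
  chebU j (1 / (2 * s)) = cheb_poly s j.+1 / s ^+ j.
Proof.
move=> two0 s0.
suff: chebU j (1 / (2 * s)) = cheb_poly s j.+1 / s ^+ j /\
      chebU j.+1 (1 / (2 * s)) = cheb_poly s j.+2 / s ^+ j.+1 by case.
elim: j => [|j [IH0 IH1]].
  by split; rewrite /= ?divr1 // mulr0 subr0; field; rewrite s0 two0.
split=> //; rewrite [LHS]/= -/(chebU j.+1 _) IH0 IH1 [in RHS]cheb_polySS.
by rewrite !exprS; field; rewrite s0 two0 expf_neq0.
Qed.

Lemma chebRE (K : fieldType) (s : K) j : 2%:R != 0 :> K -> s != 0 ->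
  chebR j s = cheb_poly s j / cheb_poly s j.+1.
Proof.
move=> two0 s0; case: j => [|j]; first by rewrite /= mul0r.
rewrite /chebR !chebUE // exprS.
have [->|p0] := eqVneq (cheb_poly s j.+2) 0.
  by rewrite mul0r mulr0 !invr0 !mulr0.
by field; rewrite p0 s0 expf_neq0.
Qed.

Lemma fcoef0_cheb_poly (F : fieldType) j :
  fcoef (cheb_poly (fpsX : fps F) j.+1) 0 = 1.
Proof.
elim: j => // j IH; rewrite cheb_polySS expr2 -mulrA.
rewrite -[LHS]/(fcoef (cheb_poly fpsX j.+1) 0 - fcoef (fpsX * _) 0).
by rewrite IH fcoef0M (_ : fcoef fpsX 0 = 0) // mul0r subr0.
Qed.

(** * Solving the functional equations *)

(** Over complex numbers this is E = 1 / (1 - i x conj(E')) for E = e + i o and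
    E' = e' + i o', and det is the squared modulus of 1 - i x conj(E'). *)
Lemma incr_system_solution (K : fieldType) (x e o e' o' det : K) :
  e = 1 + x * (o' * e - e' * o) -> o = x * (e' * e + o' * o) ->
  det = (1 - x * o') ^+ 2 + (x * e') ^+ 2 -> det != 0 ->
  e = (1 - x * o') / det /\ o = x * e' / det.
Proof.
move=> ee eo ->  d0.
move/eqP: ee; rewrite -subr_eq0 => /eqP ee.
move/eqP: eo; rewrite -subr_eq0 => /eqP eo.
split; apply: (canRL (mulfK d0)); apply/eqP; rewrite -subr_eq0; apply/eqP.
  rewrite -[RHS](addr0 0) -{1}(mulr0 (1 - x * o')) -{1}ee -(mulr0 (- x * e')).
  by rewrite -eo; ring.
rewrite -[RHS](addr0 0) -{1}(mulr0 (x * e')) -{1}ee -(mulr0 (1 - x * o')).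
by rewrite -eo; ring.
Qed.

(** With E_j = e_j + i o_j this says that E_(2j) = R_j / (1 - i x R_j) and
    E_(2j+1) = 1 + i x R_j.  The determinant of the
    step from E_(2j) is 1 / (1 + x^2 R_j^2), and that of the step from E_(2j+1)
    is (1 - x^2 R_j)^2 + x^2 = (1 + x^2 R_(j+1)^2) / R_(j+1)^2. *)
Lemma incr_parity_parts (K : fieldType) (x : K) (e o R : nat -> K) :
  R 0 = 0 -> (forall j, 1 - x ^+ 2 * R j != 0) ->
  (forall j, R j.+1 = 1 / (1 - x ^+ 2 * R j)) ->
  (forall j, 1 + x ^+ 2 * R j ^+ 2 != 0) ->
  e 0 = 0 -> o 0 = 0 ->
  (forall j, e j.+1 = 1 + x * (o j * e j.+1 - e j * o j.+1)) ->
  (forall j, o j.+1 = x * (e j * e j.+1 + o j * o j.+1)) ->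
  forall j,
    [/\ e j.*2 = R j / (1 + x ^+ 2 * R j ^+ 2),
        o j.*2 = x * R j ^+ 2 / (1 + x ^+ 2 * R j ^+ 2),
        e j.*2.+1 = 1 & o j.*2.+1 = x * R j].
Proof.
move=> R0 r0 RS q0 e0 o0 eS oS j.
have odd_step i : e i.*2 = R i / (1 + x ^+ 2 * R i ^+ 2) ->
     o i.*2 = x * R i ^+ 2 / (1 + x ^+ 2 * R i ^+ 2) ->
     e i.*2.+1 = 1 /\ o i.*2.+1 = x * R i.
  move=> ei oi; have qi := q0 i.
  have [||-> ->] := incr_system_solution
    (det := (1 + x ^+ 2 * R i ^+ 2)^-1) (eS i.*2) (oS i.*2).
  - by rewrite ei oi; field; rewrite exprMn.
  - by rewrite invr_eq0.
  by rewrite ei oi; split; field; rewrite exprMn qi oner_eq0.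
elim: j => [|j [_ _ ej oj]].
  have [||-> ->] := odd_step 0; rewrite ?e0 ?o0 R0 ?expr0n ?mulr0 ?mul0r //.
have [rj qj] := (r0 j, q0 j.+1).
have eqq : (1 + x ^+ 2 * R j.+1 ^+ 2) * (1 - x ^+ 2 * R j) ^+ 2 =
  (1 - x ^+ 2 * R j) ^+ 2 + x ^+ 2.
  by rewrite RS; field.
(* A sum of two squares may vanish in K; this one is a product of nonzero factors. *)
have d0 : (1 - x ^+ 2 * R j) ^+ 2 + x ^+ 2 != 0.
  by rewrite -eqq mulf_neq0 // expf_neq0.
have [||ej' oj'] := incr_system_solution
    (det := (1 - x ^+ 2 * R j) ^+ 2 + x ^+ 2) (eS j.*2.+1) (oS j.*2.+1).
- by rewrite ej oj; ring.
- by [].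
have [ej2 oj2]: e j.+1.*2 = R j.+1 / (1 + x ^+ 2 * R j.+1 ^+ 2) /\
     o j.+1.*2 = x * R j.+1 ^+ 2 / (1 + x ^+ 2 * R j.+1 ^+ 2).
  rewrite doubleS ej' oj' ej oj -eqq RS.
  by split; field; rewrite rj d0.
by have [ej3 oj3] := odd_step _ ej2 oj2.
Qed.

(** Cramer's rule for the two parts of the series of the theorem, in which a is
    R_m and b is R_d. *)
Lemma two_runs_system_solution (K : fieldType) (x a b Be Bo Te To : K) :
  x != 0 -> 1 + x ^+ 2 * b ^+ 2 != 0 ->
  1 + x ^+ 2 * (1 + x ^+ 2 * b ^+ 2) * (1 - 2 * a + x ^+ 2 * a ^+ 2) != 0 ->
  Be = b / (1 + x ^+ 2 * b ^+ 2) ->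
  Bo = x * b ^+ 2 / (1 + x ^+ 2 * b ^+ 2) ->
  Te = 1 + x * ((x * a * Te - 1 * To) + (To * Be - Te * Bo)
                - (x * a * Be - 1 * Bo)) ->
  To = x * ((1 * Te + x * a * To) + (Te * Be + To * Bo)
            - (1 * Be + x * a * Bo)) ->
  Te + To = 1 / x - ((1 - x ^+ 2 * (a - b)) *
   (1 - x ^+ 2 * (b + a) - x * (1 - x ^+ 2 * b * a))) /
  (x + x ^+ 3 * (1 + x ^+ 2 * b ^+ 2) * (1 - 2 * a + x ^+ 2 * a ^+ 2)).
Proof.
move=> x0 q0 D0 eBe eBo eTe eTo.
set u11 := 1 - x * (x * a) + x * Bo; set u12 := x * (1 - Be).
set u21 := - (x * (1 + Be)); set u22 := 1 - x * (x * a) - x * Bo.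
set c1 := 1 - x * (x * a * Be - Bo); set c2 := - (x * (Be + x * a * Bo)).
have E1 : u11 * Te + u12 * To = c1.
  apply/eqP; rewrite -subr_eq0; apply/eqP.
  by move/eqP: eTe; rewrite -subr_eq0 => /eqP <-; rewrite /u11 /u12 /c1; ring.
have E2 : u21 * Te + u22 * To = c2.
  apply/eqP; rewrite -subr_eq0; apply/eqP.
  by move/eqP: eTo; rewrite -subr_eq0 => /eqP <-; rewrite /u21 /u22 /c2; ring.
set q := 1 + x ^+ 2 * b ^+ 2 in q0 D0 eBe eBo *.
set D := 1 + x ^+ 2 * q * (1 - 2 * a + x ^+ 2 * a ^+ 2) in D0 *.
set u := u11 * u22 - u12 * u21.
have du : u * q = D.
  rewrite /u /u11 /u12 /u21 /u22 /D eBe eBo /q; field.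
  by rewrite exprMn.
have u0 : u != 0 by apply: contra_neq D0 => u0; rewrite -du u0 mul0r.
have -> : Te + To = (c1 * (u22 - u21) + c2 * (u11 - u12)) / u.
  by apply: (canRL (mulfK u0)); rewrite -E1 -E2 /u; ring.
have -> : x + x ^+ 3 * q * (1 - 2 * a + x ^+ 2 * a ^+ 2) = x * D.
  by rewrite /D; ring.
have -> : (c1 * (u22 - u21) + c2 * (u11 - u12)) / u =
    (c1 * (u22 - u21) + c2 * (u11 - u12)) * q / D.
  by rewrite -du; field; rewrite u0 q0.
apply: (mulIf (mulf_neq0 D0 x0)).
have -> : (c1 * (u22 - u21) + c2 * (u11 - u12)) * q / D * (D * x) =
   x * ((c1 * (u22 - u21) + c2 * (u11 - u12)) * q) by field.
rewrite [RHS]mulrBl.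
have -> y : y / (x * D) * (D * x) = y by field; rewrite x0 D0.
have -> : 1 / x * (D * x) = D by field.
rewrite /D /c1 /c2 /u11 /u12 /u21 /u22 eBe eBo /q; field.
by rewrite exprMn.
Qed.

(** The field of Laurent series only matters as a field in which power series
    embed and 2 is invertible. *)
Section Embedding.
Variables (F K : fieldType) (phi : {rmorphism fps F -> K}).
Hypotheses (phi_inj : injective phi) (two_neq0 : 2%:R != 0 :> K).
Local Notation x := (phi fpsX).

Lemma phi_neq0 f : fcoef f 0 != 0 -> phi f != 0.
Proof.
by rewrite -(rmorph0 phi) (inj_eq phi_inj); apply: contra_neq => ->.
Qed.

Lemma phiX_neq0 : x != 0.
Proof.
rewrite -(rmorph0 phi) (inj_eq phi_inj).
by apply/eqP => /fpsP /(_ 1%N) /eqP; rewrite oner_eq0.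
Qed.

Lemma phi_chebRE j :
  chebR j x = phi (cheb_poly fpsX j) / phi (cheb_poly fpsX j.+1).
Proof.
by rewrite chebRE ?phiX_neq0 ?rmorph_cheb_poly.
Qed.

Lemma phi_cheb_neq0 j : phi (cheb_poly (fpsX : fps F) j.+1) != 0.
Proof. by rewrite phi_neq0 // fcoef0_cheb_poly oner_eq0. Qed.

Lemma chebR_denom_neq0 j : 1 - x ^+ 2 * chebR j x != 0.
Proof.
have p0 := phi_cheb_neq0 j; rewrite phi_chebRE.
have -> : 1 - x ^+ 2 * (phi (cheb_poly fpsX j) / phi (cheb_poly fpsX j.+1))
  = phi (cheb_poly fpsX j.+2) / phi (cheb_poly fpsX j.+1).
  by rewrite cheb_polySS rmorphB rmorphM rmorphXn; field.
by rewrite mulf_neq0 ?invr_eq0 ?phi_cheb_neq0.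
Qed.

Lemma chebR_rec j : chebR j.+1 x = 1 / (1 - x ^+ 2 * chebR j x).
Proof.
have p0 := phi_cheb_neq0 j; have p1 := phi_cheb_neq0 j.+1.
rewrite !phi_chebRE.
have e : phi (cheb_poly fpsX j.+2) = phi (cheb_poly fpsX j.+1) -
  x ^+ 2 * phi (cheb_poly fpsX j).
  by rewrite cheb_polySS rmorphB rmorphM rmorphXn.
by rewrite e in p1 *; field; rewrite p0 p1.
Qed.

Lemma chebR_square_neq0 j : 1 + x ^+ 2 * chebR j x ^+ 2 != 0.
Proof.
have p0 := phi_cheb_neq0 j; rewrite phi_chebRE.
set q := cheb_poly fpsX j; set p := cheb_poly fpsX j.+1 in p0 *.
have -> : 1 + x ^+ 2 * (phi q / phi p) ^+ 2 =
  phi (p ^+ 2 + fpsX * (fpsX * q ^+ 2)) / phi p ^+ 2.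
  by rewrite !rmorphE /=; field.
rewrite mulf_neq0 ?invr_eq0 ?expf_neq0 // phi_neq0 // fcoef0D !fcoef0M.
by rewrite fcoef0_cheb_poly mul0r addr0 mulr1 oner_eq0.
Qed.

(** After multiplication by the squares of the denominators of R_d and R_m, this
    is the image of a power series with constant term 1. *)
Lemma two_runs_det_neq0 d m :
  1 + x ^+ 2 * (1 + x ^+ 2 * chebR d x ^+ 2) *
    (1 - 2 * chebR m x + x ^+ 2 * chebR m x ^+ 2) != 0.
Proof.
have pd := phi_cheb_neq0 d; have pm := phi_cheb_neq0 m.
rewrite !phi_chebRE.
set qm := cheb_poly fpsX m; set pm' := cheb_poly fpsX m.+1 in pm *.
set qd := cheb_poly fpsX d; set pd' := cheb_poly fpsX d.+1 in pd *.
set D := (X in X != 0).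
have -> : D = phi (pd' ^+ 2 * pm' ^+ 2 + fpsX * (fpsX *
    (pd' ^+ 2 + fpsX ^+ 2 * qd ^+ 2) *
    (pm' ^+ 2 - 2 * qm * pm' + fpsX ^+ 2 * qm ^+ 2)))
   / (phi pd' ^+ 2 * phi pm' ^+ 2).
  by rewrite /D !rmorphE /= ; field; rewrite pd pm.
rewrite mulf_neq0 ?invr_eq0 ?mulf_neq0 ?expf_neq0 // phi_neq0 //.
by rewrite fcoef0D !fcoef0M !fcoef0_cheb_poly mul0r addr0 !mulr1 oner_eq0.
Qed.

Lemma two_runs_series (I : nat -> fps F) (T : fps F) (d m : nat) :
  I 0 = 0 -> (forall j, fcoef (I j.+1) 0 = 1) ->
  (forall j n, fcoef (I j.+1) n.+1 = fcoef (fps_twist (I j) (I j.+1)) n) ->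
  fcoef T 0 = 1 ->
  (forall n, fcoef T n.+1 =
     fcoef (fps_twist (I m.*2.+1) T + fps_twist T (I d.*2)
            - fps_twist (I m.*2.+1) (I d.*2)) n) ->
  let a := chebR m x in let b := chebR d x in
  phi T = 1 / x - ((1 - x ^+ 2 * (a - b)) *
   (1 - x ^+ 2 * (b + a) - x * (1 - x ^+ 2 * b * a))) /
  (x + x ^+ 3 * (1 + x ^+ 2 * b ^+ 2) * (1 - 2 * a + x ^+ 2 * a ^+ 2)).
Proof.
move=> I0 I1 IS T0 TS a b.
have evD f g : fps_even (f + g) = fps_even f + fps_even g :> fps F.
  by apply/fpsP => n /=; case: odd; rewrite ?addr0.
have odD f g : fps_odd (f + g) = fps_odd f + fps_odd g :> fps F.
  by apply/fpsP => n /=; case: odd; rewrite ?addr0.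
have evN f : fps_even (- f) = - fps_even f :> fps F.
  by apply/fpsP => n /=; case: odd; rewrite ?oppr0.
have odN f : fps_odd (- f) = - fps_odd f :> fps F.
  by apply/fpsP => n /=; case: odd; rewrite ?oppr0.
pose e j := phi (fps_even (I j)); pose o j := phi (fps_odd (I j)).
have e0 : e 0 = 0.
  rewrite /e I0 -(rmorph0 phi); congr (phi _).
  by apply/fpsP => n /=; case: odd.
have o0 : o 0 = 0.
  rewrite /o I0 -(rmorph0 phi); congr (phi _).
  by apply/fpsP => n /=; case: odd.
have eS j : e j.+1 = 1 + x * (o j * e j.+1 - e j * o j.+1).
  have [eq1 _] := fps_parity_shift (I1 j) (IS j).
  by rewrite /e {1}eq1 fps_odd_twist rmorphD rmorph1 rmorphM rmorphB !rmorphM.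
have oS j : o j.+1 = x * (e j * e j.+1 + o j * o j.+1).
  have [_ eq1] := fps_parity_shift (I1 j) (IS j).
  by rewrite /o {1}eq1 fps_even_twist rmorphM rmorphD !rmorphM.
have parts := incr_parity_parts (R := fun j => chebR j x) erefl
  chebR_denom_neq0 chebR_rec chebR_square_neq0 e0 o0 eS oS.
have [ed od _ _] := parts d; have [_ _ em om] := parts m.
have [evT odT] := fps_parity_shift T0 TS.
rewrite -{1}[T]fps_even_odd rmorphD.
have eqe : phi (fps_even T) = 1 + x *
    ((o m.*2.+1 * phi (fps_even T) - e m.*2.+1 * phi (fps_odd T))
     + (phi (fps_odd T) * e d.*2 - phi (fps_even T) * o d.*2)
     - (o m.*2.+1 * e d.*2 - e m.*2.+1 * o d.*2)).
  rewrite {1}evT odD odN odD !fps_odd_twist rmorphD rmorph1 rmorphM.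
  by rewrite !(rmorphD, rmorphN, rmorphM).
have eqo : phi (fps_odd T) = x *
    ((e m.*2.+1 * phi (fps_even T) + o m.*2.+1 * phi (fps_odd T))
     + (phi (fps_even T) * e d.*2 + phi (fps_odd T) * o d.*2)
     - (e m.*2.+1 * e d.*2 + o m.*2.+1 * o d.*2)).
  rewrite {1}odT evD evN evD !fps_even_twist rmorphM.
  by rewrite !(rmorphD, rmorphN, rmorphM).
rewrite em om in eqe eqo.
exact: (two_runs_system_solution phiX_neq0 (chebR_square_neq0 d)
  (two_runs_det_neq0 d m) ed od eqe eqo).
Qed.

End Embedding.

Theorem theorem2p23 (k d : nat) (hd : (1 <= d <= k - 1)%N) :
  let m := (k - d - 1)%N in
  let x : {fraction (fps rat)} := tofrac (fpsX : fps rat) in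
  let Rd := chebR d x in
  let Rm := chebR m x in
  tofrac (gfM (pat (2 * k) (2 * d))) =
  1 / x -
  ((1 - x ^+ 2 * (Rm - Rd)) *
   (1 - x ^+ 2 * (Rd + Rm) - x * (1 - x ^+ 2 * Rd * Rm))) /
  (x + x ^+ 3 * (1 + x ^+ 2 * Rd ^+ 2) * (1 - 2 * Rm + x ^+ 2 * Rm ^+ 2)).
Proof.
move=> m x Rd Rm; have d0 : (0 < d.*2)%N by rewrite double_gt0; case/andP: hd.
have -> : gfM (pat (2 * k) (2 * d)) = signed_gf_two_runs m.*2.+2 d.*2.
(* The first run has 2k - 2d = 2m + 2 letters. *)
  have -> : (2 * k = m.*2.+2 + d.*2)%N by rewrite /m; lia.
  rewrite mul2n gfM_signed_gf; apply/fpsP => n; apply: eq_bigr => w _.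
  by rewrite /word_avoids (asbool_equiv_eq (contains_pat_has_two_runs _ _ w)).
apply: (@two_runs_series _ _ (@tofrac (fps rat)) _ _ signed_gf_incr _ d m).
- by move=> f g /eqP; rewrite tofrac_eq => /eqP.
- rewrite -(rmorph_nat (@tofrac (fps rat))) tofrac_eq0.
  by apply/eqP => /fpsP /(_ 0%N).
- exact: signed_gf_incr0.
- exact: signed_gf_incrS_nil.
- exact: signed_gf_incrS.
- exact: signed_gf_two_runs_nil.
by move=> n; apply: signed_gf_two_runsS.
Qed.
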